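(* Let $H$ be an infinite finitely generated amenable group and let $F_2$ be the free group on two generators. There is no action of $F_2$ by permutations on the set $H$ that is transitive, almost free, and such that every $H$-invariant mean on $H$ is $F_2$-invariant.
   Context: A mean on $H$ is a finitely additive $\mu:2^H\to[0,1]$ with $\mu(H)=1$; it is $H$-invariant if $\mu(hA)=\mu(A)$ for all $h\in H$, $A\subseteq H$ (invariance under left multiplication), and $F_2$-invariant if $\mu(gA)=\mu(A)$ for all $g\in F_2$. An action is almost free if every nontrivial element fixes only finitely many points. *)

(* Defs.v *)
From Stdlib Require Import Reals List Bool.
Import ListNotations.
Open Scope R_scope.

Definition is_group {H : Type} (mul : H -> H -> H) (one : H) (inv : H -> H) : Prop :=
  (forall x y z, mul x (mul y z) = mul (mul x y) z) /\
  (forall x, mul one x = x) /\ (forall x, mul x one = x) /\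
  (forall x, mul (inv x) x = one) /\ (forall x, mul x (inv x) = one).

Definition infinite_type (H : Type) : Prop :=
  ~ exists l : list H, forall h : H, In h l.

Inductive generated {H : Type} (mul : H -> H -> H) (one : H) (inv : H -> H)
    (S : list H) : H -> Prop :=
| gen_base : forall s, In s S -> generated mul one inv S s
| gen_one : generated mul one inv S one
| gen_mul : forall x y, generated mul one inv S x -> generated mul one inv S y ->
            generated mul one inv S (mul x y)
| gen_inv : forall x, generated mul one inv S x -> generated mul one inv S (inv x).

Definition finitely_generated {H : Type} (mul : H -> H -> H) (one : H) (inv : H -> H) : Prop :=
  exists S : list H, forall h, generated mul one inv S h.

Definition is_mean {X : Type} (mu : (X -> Prop) -> R) : Prop :=
  (forall A, 0 <= mu A <= 1) /\
  mu (fun _ => True) = 1 /\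
  (forall A B : X -> Prop, (forall x, A x -> B x -> False) ->
     mu (fun x => A x \/ B x) = mu A + mu B).

Definition img {X : Type} (f : X -> X) (A : X -> Prop) : X -> Prop :=
  fun x => exists a, A a /\ x = f a.

Definition H_invariant {H : Type} (mul : H -> H -> H) (mu : (H -> Prop) -> R) : Prop :=
  forall h A, mu (img (mul h) A) = mu A.

Definition amenable {H : Type} (mul : H -> H -> H) : Prop :=
  exists mu : (H -> Prop) -> R, is_mean mu /\ H_invariant mul mu.

(** * The free group F_2 on generators a, b as reduced words.
    A letter (i, s): i = false for a, true for b; s = true for the generator,
    false for its inverse. *)
Definition letter := (bool * bool)%type.

Definition cancels (l m : letter) : bool :=
  Bool.eqb (fst l) (fst m) && negb (Bool.eqb (snd l) (snd m)).

Fixpoint reduced (w : list letter) : bool :=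
  match w with
  | [] => true
  | l :: w' => match w' with
               | [] => true
               | m :: _ => negb (cancels l m) && reduced w'
               end
  end.

Definition F2elt (w : list letter) : Prop := reduced w = true.

Definition cons_red (l : letter) (w : list letter) : list letter :=
  match w with
  | m :: w' => if cancels l m then w' else l :: w
  | [] => [l]
  end.

Definition F2mul (u v : list letter) : list letter := fold_right cons_red v u.

(** An action of F_2 on X (by permutations): a map from F_2 to functions
    X -> X that is a group homomorphism (hence lands in permutations). *)
Definition F2_action {X : Type} (act : list letter -> X -> X) : Prop :=
  (forall x, act [] x = x) /\
  (forall u v, F2elt u -> F2elt v -> forall x, act (F2mul u v) x = act u (act v x)).

Definition F2_transitive {X : Type} (act : list letter -> X -> X) : Prop :=
  forall x y : X, exists g, F2elt g /\ act g x = y.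

Definition F2_almost_free {X : Type} (act : list letter -> X -> X) : Prop :=
  forall g, F2elt g -> g <> [] ->
    exists l : list X, forall x, act g x = x -> In x l.

Definition F2_invariant {X : Type} (act : list letter -> X -> X)
    (mu : (X -> Prop) -> R) : Prop :=
  forall g, F2elt g -> forall A, mu (img (act g) A) = mu A.

(* Main.v *)
(** Along a free ultrafilter, each relation [s k x = k' x] between letters [s] and
    points [k x], [k' x] of a translate [K x] of a finite set [K] either holds
    for almost every [x] or fails for almost every [x].  A closed walk in the
    pattern of relations that hold almost everywhere makes a word fix infinitely
    many points, so by almost freeness the word is trivial: hence almost every
    [K x] spans no nontrivial cycle of the Schreier graph.  Choose finite sets
    [K_n] exhausting [H] and points [x_n] far enough apart; then [A], the union
    of the [K_n x_n], spans no nontrivial cycle either, so it carries an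
    equivariant labelling by elements of [F_2].  If [nu] is an invariant mean
    and [V] a free ultrafilter on the indices, then
    [B |-> nu {h | h x_n is in B for V-almost all n}]
    is an [H]-invariant mean giving mass 1 to [A].  Were it [F_2]-invariant, the
    labelling would carry it to an invariant mean on [F_2], against the
    paradoxical decomposition of [F_2] by first letters. *)
Require Import Defs.
From Stdlib Require Import Reals List.
From Stdlib Require Import Bool Arith Lia Lra ClassicalEpsilon
  FunctionalExtensionality PropExtensionality.
From mathcomp Require filter.
Import ListNotations.

Lemma pred_ext {X : Type} (A B : X -> Prop) : (forall x, A x <-> B x) -> A = B.
Proof.
  intros E. apply functional_extensionality. intros x.
  apply propositional_extensionality. apply E.
Qed.

(** * Finitely additive means *)

Lemma mean_le {X : Type} (mu : (X -> Prop) -> R) (A B : X -> Prop) :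
  is_mean mu -> (forall x, A x -> B x) -> mu A <= mu B.
Proof.
  intros (Hr & _ & Ha) AB.
  replace B with (fun x => A x \/ (B x /\ ~ A x)).
  - rewrite Ha by tauto. pose proof (Hr (fun x => B x /\ ~ A x)). lra.
  - apply pred_ext. intros x. specialize (AB x). tauto.
Qed.

Lemma mean_union_le {X : Type} (mu : (X -> Prop) -> R) (A B : X -> Prop) :
  is_mean mu -> mu (fun x => A x \/ B x) <= mu A + mu B.
Proof.
  intros Hmu.
  replace (fun x => A x \/ B x) with (fun x => A x \/ (B x /\ ~ A x)).
  - rewrite (proj2 (proj2 Hmu)) by tauto.
    pose proof (mean_le mu (fun x => B x /\ ~ A x) B Hmu). firstorder lra.
  - apply pred_ext. intros x. tauto.
Qed.

Lemma mean_inter_full {X : Type} (mu : (X -> Prop) -> R) (A B : X -> Prop) :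
  is_mean mu -> mu A = 1 -> mu B = 1 -> mu (fun x => A x /\ B x) = 1.
Proof.
  intros Hmu HA HB.
  pose proof Hmu as (Hr & H1 & Ha).
  assert (E : mu (fun x => (A x /\ B x) \/ ~ (A x /\ B x)) = 1).
  { rewrite <- H1. f_equal. apply pred_ext. intros x. tauto. }
  assert (EA : mu (fun x => A x \/ ~ A x) = 1).
  { rewrite <- H1. f_equal. apply pred_ext. intros x. tauto. }
  assert (EB : mu (fun x => B x \/ ~ B x) = 1).
  { rewrite <- H1. f_equal. apply pred_ext. intros x. tauto. }
  rewrite Ha in E by tauto. rewrite Ha in EA by tauto. rewrite Ha in EB by tauto.
  pose proof (mean_union_le mu (fun x => ~ A x) (fun x => ~ B x) Hmu).
  assert (mu (fun x => ~ (A x /\ B x)) <= mu (fun x => ~ A x \/ ~ B x)).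
  { apply mean_le; [assumption | intros x; tauto]. }
  pose proof (Hr (fun x => A x /\ B x)). lra.
Qed.

(** * Words and the free group *)

Definition linv (l : letter) : letter := (fst l, negb (snd l)).

Definition winv (w : list letter) : list letter := rev (map linv w).

Lemma linv_involutive (l : letter) : linv (linv l) = l.
Proof. destruct l as [[] []]; reflexivity. Qed.

Lemma cancels_iff (l m : letter) : cancels l m = true <-> m = linv l.
Proof. destruct l as [[] []], m as [[] []]; cbv; intuition congruence. Qed.

Lemma reduced_cons_red (l : letter) (w : list letter) :
  reduced w = true -> reduced (cons_red l w) = true.
Proof.
  destruct w as [|m w]; [reflexivity|]. intros Hw. unfold cons_red.
  destruct (cancels l m) eqn:E.
  - destruct w as [|m' w]; [reflexivity|].
    simpl in Hw. apply andb_true_iff in Hw. apply Hw.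
  - change (negb (cancels l m) && reduced (m :: w) = true). now rewrite E.
Qed.

Lemma reduced_F2mul (u v : list letter) :
  reduced v = true -> reduced (F2mul u v) = true.
Proof.
  intros Hv. induction u as [|l u IH]; [exact Hv|]. now apply reduced_cons_red.
Qed.

Lemma cons_red_linv (l : letter) (w : list letter) :
  reduced w = true -> cons_red l (cons_red (linv l) w) = w.
Proof.
  intros Hw. destruct w as [|m w].
  - simpl. now rewrite (proj2 (cancels_iff l (linv l)) eq_refl).
  - simpl. destruct (cancels (linv l) m) eqn:E.
    + apply cancels_iff in E. rewrite linv_involutive in E. subst m.
      destruct w as [|m' w]; [reflexivity|].
      simpl in Hw |- *. destruct (cancels l m'); [discriminate|reflexivity].
    + simpl. now rewrite (proj2 (cancels_iff l (linv l)) eq_refl).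
Qed.

Lemma F2mul_app (u v w : list letter) : F2mul (u ++ v) w = F2mul u (F2mul v w).
Proof. apply fold_right_app. Qed.

Lemma F2mul_winv (w v : list letter) :
  reduced v = true -> F2mul w (F2mul (winv w) v) = v.
Proof.
  revert v. induction w as [|l w IH]; intros v Hv; [reflexivity|].
  change (winv (l :: w)) with (winv w ++ [linv l]). rewrite F2mul_app.
  change (cons_red l (F2mul w (F2mul (winv w) (cons_red (linv l) v))) = v).
  rewrite IH by now apply reduced_cons_red. now apply cons_red_linv.
Qed.

(** Reduced form of an arbitrary word: words read off walks need not be reduced, while [F2_action]
    speaks only of reduced ones. *)
Definition norm (w : list letter) : list letter := F2mul w [].

Lemma act_linv {X : Type} (act : list letter -> X -> X) (l : letter) (x : X) :
  F2_action act -> act [linv l] (act [l] x) = x.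
Proof.
  intros [H1 HM]. rewrite <- HM by reflexivity.
  unfold F2mul, fold_right, cons_red.
  now rewrite (proj2 (cancels_iff (linv l) l) (eq_sym (linv_involutive l))).
Qed.

Lemma act_norm_cons {X : Type} (act : list letter -> X -> X) (l : letter)
    (w : list letter) (x : X) :
  F2_action act -> act (norm (l :: w)) x = act [l] (act (norm w) x).
Proof.
  intros [_ HM]. rewrite <- HM; [reflexivity|reflexivity|].
  now apply reduced_F2mul.
Qed.

(** * Walks and labellings *)

(** The head letter is the step taken last, so a word acts from the left along its walk. *)
Inductive walk {X : Type} (E : letter -> X -> X -> Prop) :
    list letter -> X -> X -> Prop :=
| walk_nil : forall x, walk E [] x x
| walk_cons : forall l w x y z,
    walk E w x y -> E l y z -> walk E (l :: w) x z.

Lemma walk_app {X : Type} (E : letter -> X -> X -> Prop) u v x y z :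
  walk E u y z -> walk E v x y -> walk E (u ++ v) x z.
Proof.
  intros Hu Hv. induction Hu as [|l u y y' z Hu IH He]; [exact Hv|].
  simpl. econstructor; eauto.
Qed.

Lemma walk_winv {X : Type} (E : letter -> X -> X -> Prop) w x y :
  (forall l a b, E l a b -> E (linv l) b a) -> walk E w x y -> walk E (winv w) y x.
Proof.
  intros Hs Hw. induction Hw as [|l w x y z Hw IH He]; [constructor|].
  change (winv (l :: w)) with (winv w ++ [linv l]).
  eapply walk_app; [exact IH|].
  econstructor; [constructor | now apply Hs].
Qed.

(** Closed walks may backtrack; what is excluded is one whose word is nontrivial in the free
    group. *)
Definition acyclic {X : Type} (E : letter -> X -> X -> Prop) : Prop :=
  forall w x, walk E w x x -> norm w = [].

(** Label a point by the reduced word of a path from the root of its component; acyclicity makes the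
    choice of path immaterial. *)
Lemma acyclic_labelling {X : Type} (E : letter -> X -> X -> Prop) :
  (forall l a b, E l a b -> E (linv l) b a) -> acyclic E ->
  exists sigma : X -> list letter,
    forall l x y, E l x y -> sigma y = cons_red l (sigma x).
Proof.
  intros Hs Hac.
  pose (conn := fun x r => exists w, walk E w r x).
  (* [epsilon] sees only the predicate [conn x], shared by a whole component; the proofs
     [inhabits x] agree by proof irrelevance. *)
  pose (root := fun x => epsilon (inhabits x) (conn x)).
  assert (Hroot : forall x, exists w, walk E w (root x) x).
  { intros x. apply (epsilon_spec (inhabits x) (conn x)).
    exists x, []. constructor. }
  destruct (choice _ Hroot) as [path Hpath].
  exists (fun x => norm (path x)). intros l x y He.
  assert (Er : root x = root y).
  { unfold root. replace (conn y) with (conn x).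
    - f_equal. apply proof_irrelevance.
    - apply pred_ext. intros r. split; intros [w Hw].
      + exists (l :: w). econstructor; eauto.
      + exists (linv l :: w). econstructor; eauto. }
  (* From the root to [x], across the edge to [y], and back along the reversed path to [y]. *)
  assert (Hc : walk E (winv (path y) ++ l :: path x) (root x) (root x)).
  { eapply walk_app.
    - apply walk_winv; [exact Hs|]. rewrite Er. apply Hpath.
    - econstructor; [apply Hpath | exact He]. }
  apply Hac in Hc. unfold norm in Hc. rewrite F2mul_app in Hc.
  change (F2mul (path y) [] = F2mul (l :: path x) []).
  rewrite <- (F2mul_winv (path y) (F2mul (l :: path x) [])) by now apply reduced_F2mul.
  now rewrite Hc.
Qed.

Definition step {X : Type} (act : list letter -> X -> X) (A : X -> Prop)
    (l : letter) (x y : X) : Prop :=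
  A x /\ A y /\ y = act [l] x.

Lemma step_sym {X : Type} (act : list letter -> X -> X) (A : X -> Prop) :
  F2_action act -> forall l x y, step act A l x y -> step act A (linv l) y x.
Proof.
  intros Hact l x y (Ax & Ay & ->). repeat split; auto. now rewrite act_linv.
Qed.

(** No edge joins two different pieces, so a walk starting in one piece stays in it. *)
Lemma acyclic_union {X I : Type} (act : list letter -> X -> X) (B : I -> X -> Prop) :
  (forall i, acyclic (step act (B i))) ->
  (forall i j l x, B i x -> B j (act [l] x) -> i = j) ->
  acyclic (step act (fun x => exists i, B i x)).
Proof.
  (* An empty walk may sit outside the union; a nonempty one cannot. *)
  intros Hac Hsep w x Hw. destruct w as [|l0 w]; [reflexivity|].
  assert (Hx : exists i, B i x).
  { inversion Hw; subst. match goal with H : step _ _ _ _ _ |- _ => apply H end. }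
  destruct Hx as [i Hi].
  assert (Hstay : forall u z y, walk (step act (fun x => exists i, B i x)) u z y ->
            B i z -> B i y /\ walk (step act (B i)) u z y);
    [|exact (Hac i _ _ (proj2 (Hstay _ _ _ Hw Hi)))].
  clear x l0 w Hw Hi. intros u z y Hw Hz. induction Hw as [z|l u z y y' Hw IH He].
  - split; [exact Hz | constructor].
  - destruct (IH Hz) as [Hy Hwy]. destruct He as (_ & [j Hj] & ->).
    destruct (Hsep i j l y Hy Hj). split; [exact Hj|].
    econstructor; [exact Hwy|]. now repeat split.
Qed.

(** Let [P l] be the points of [A] whose label starts with [l]. Then [P l] and the translate by [l]
    of [P (linv l)] cover almost everything, so the four disjoint sets [P l] would have total mass
    at least 2. *)
Lemma no_equivariant_labelling {X : Type} (act : list letter -> X -> X)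
    (mu : (X -> Prop) -> R) (A : X -> Prop) (sigma : X -> list letter) :
  is_mean mu -> F2_invariant act mu -> mu A = 1 ->
  ~ (forall l x y, step act A l x y -> sigma y = cons_red l (sigma x)).
Proof.
  intros Hmu Hinv HA Hsig.
  pose (P := fun l x => A x /\ exists w, sigma x = l :: w).
  assert (Hpair : forall l, 1 <= mu (P l) + mu (P (linv l))).
  { intros l. rewrite <- (Hinv [l] eq_refl (P (linv l))).
    eapply Rle_trans; [|apply mean_union_le; exact Hmu].
    (* Almost every [x] lies in [A] and is [act [l] y] with [y] in [A], which is an edge inside
       [A]. *)
    rewrite <- (mean_inter_full mu A (img (act [l]) A) Hmu HA);
      [|now rewrite Hinv].
    apply mean_le; [exact Hmu|]. intros x [Ax [y [Ay Exy]]].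
    assert (E : sigma x = cons_red l (sigma y)) by (apply Hsig; now repeat split).
    destruct (sigma y) as [|m w] eqn:Ey.
    - left. split; [exact Ax|]. now exists [].
    - simpl in E. destruct (cancels l m) eqn:C.
      + apply cancels_iff in C. subst m. right. exists y. repeat split; eauto.
      + left. split; eauto. }
  assert (Hdisj : forall l m x, P l x -> P m x -> l = m).
  { intros l m x [_ [w Hw]] [_ [w' Hw']]. congruence. }
  pose (a := (false, true) : letter). pose (b := (true, true) : letter).
  pose proof (Hpair a). pose proof (Hpair b).
  assert (Hsum : mu (P a) + mu (P (linv a)) + (mu (P b) + mu (P (linv b))) <= 1).
  { pose proof Hmu as (Hr & _ & Hadd).
    rewrite <- !Hadd; [apply Hr| | |];
      intros x Hx Hy; repeat destruct Hx as [Hx|Hx]; repeat destruct Hy as [Hy|Hy];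
      discriminate (Hdisj _ _ _ Hx Hy). }
  lra.
Qed.

(** * Free ultrafilters *)

Record free_ultrafilter {X : Type} (U : (X -> Prop) -> Prop) : Prop := {
  fu_mono : forall A B : X -> Prop, (forall x, A x -> B x) -> U A -> U B;
  fu_inter : forall A B, U A -> U B -> U (fun x => A x /\ B x);
  fu_em : forall A, U A \/ U (fun x => ~ A x);
  fu_false : ~ U (fun _ => False);
  fu_cofinite : forall l, U (fun x => ~ In x l)
}.

Lemma free_ultrafilter_exists (X : Type) :
  infinite_type X -> exists U : (X -> Prop) -> Prop, free_ultrafilter U.
Proof.
  intros Hinf.
  (* The cofinite filter, proper because [X] is infinite. *)
  pose (F := fun A : X -> Prop => exists l, forall x, ~ In x l -> A x).
  destruct (filter.ultraFilterLemma (F := F)) as [U [HU HFU]].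
  { constructor.
    - intros [l Hl]. apply Hinf. exists l. intros h. apply NNPP. exact (Hl h).
    - constructor.
      + exists []. intros x _. exact I.
      + intros A B [l Hl] [m Hm]. exists (l ++ m). intros x Hx.
        rewrite in_app_iff in Hx. split; [apply Hl | apply Hm]; tauto.
      + intros A B AB [l Hl]. exists l. intros x Hx. apply AB. now apply Hl. }
  pose proof (filter.ultra_proper (UltraFilter := HU)) as HP.
  exists U. constructor.
  - intros A B AB HA. exact (filter.filterS AB HA).
  - intros A B HA HB. exact (filter.filterI HA HB).
  - intros A. exact (filter.in_ultra_setVsetC A HU).
  - exact (filter.filter_not_empty U).
  - intros l. apply HFU. exists l. auto.
Qed.

Lemma fu_true {X : Type} (U : (X -> Prop) -> Prop) (A : X -> Prop) :
  free_ultrafilter U -> (forall x, A x) -> U A.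
Proof.
  intros HU HA. eapply fu_mono; [exact HU | | apply (fu_cofinite U HU [])]. auto.
Qed.

Lemma fu_inhabited {X : Type} (U : (X -> Prop) -> Prop) (A : X -> Prop) :
  free_ultrafilter U -> U A -> exists x, A x.
Proof.
  intros HU HA. apply NNPP. intros N. apply (fu_false U HU).
  eapply fu_mono; [exact HU | | exact HA]. intros x Ax. apply N. now exists x.
Qed.

Lemma fu_forall_in {X Y : Type} (U : (X -> Prop) -> Prop) (l : list Y)
    (P : Y -> X -> Prop) :
  free_ultrafilter U -> (forall y, In y l -> U (P y)) ->
  U (fun x => forall y, In y l -> P y x).
Proof.
  intros HU. induction l as [|a l IH]; intros HP.
  - apply fu_true; [exact HU | intros x y []].
  - eapply fu_mono; [exact HU | | apply (fu_inter U HU (P a)); [|apply IH]].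
    + intros x [Ha Hl] y [<-|Hy]; [exact Ha | now apply Hl].
    + apply HP. now left.
    + intros y Hy. apply HP. now right.
Qed.

(** * Acyclic translates *)

Definition letters : list letter :=
  [(false, true); (false, false); (true, true); (true, false)].

Lemma in_letters (l : letter) : In l letters.
Proof. destruct l as [[] []]; simpl; tauto. Qed.

Lemma mul_cancel_l {H : Type} (mul : H -> H -> H) one inv (HG : is_group mul one inv)
    (k x : H) : mul (inv k) (mul k x) = x.
Proof. destruct HG as (HA & H1 & _ & Hi & _). now rewrite HA, Hi. Qed.

Lemma mul_cancel_inv_l {H : Type} (mul : H -> H -> H) one inv
    (HG : is_group mul one inv) (k x : H) : mul k (mul (inv k) x) = x.
Proof. destruct HG as (HA & H1 & _ & _ & Hi). now rewrite HA, Hi. Qed.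

Lemma mul_cancel_r {H : Type} (mul : H -> H -> H) one inv (HG : is_group mul one inv)
    (k k' x : H) : mul k x = mul k' x -> k = k'.
Proof.
  destruct HG as (HA & _ & H1 & _ & Hi). intros E.
  rewrite <- (H1 k), <- (H1 k'), <- (Hi x), !HA. now f_equal.
Qed.

Definition translate {H : Type} (mul : H -> H -> H) (K : list H) (x y : H) : Prop :=
  exists k, In k K /\ y = mul k x.

Lemma acyclic_translate {H : Type} (mul : H -> H -> H) one inv
    (HG : is_group mul one inv) (act : list letter -> H -> H)
    (Hact : F2_action act) (Haf : F2_almost_free act)
    (U : (H -> Prop) -> Prop) (HU : free_ultrafilter U) (K : list H) :
  U (fun x => acyclic (step act (translate mul K x))).
Proof.
  (* The pattern: an edge is a relation that holds for almost every [x]. *)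
  pose (T := fun l k k' => U (fun x => mul k' x = act [l] (mul k x))).
  (* Each of the finitely many relations over [K] is in [T] or fails almost everywhere. *)
  assert (Hgen : U (fun x => forall l, In l letters -> forall k, In k K ->
                     forall k', In k' K -> mul k' x = act [l] (mul k x) -> T l k k')).
  { apply fu_forall_in; [exact HU|]. intros l _.
    apply fu_forall_in; [exact HU|]. intros k _.
    apply fu_forall_in; [exact HU|]. intros k' _.
    destruct (fu_em U HU (fun x => mul k' x = act [l] (mul k x))) as [HT|HT].
    - apply fu_true; auto.
    - eapply fu_mono; [exact HU | | exact HT]. intros x N E. now destruct N. }
  (* Relations along a walk in the pattern compose, on a finite intersection of large sets. *)
  assert (HT : forall w k k', walk T w k k' ->
                 U (fun x => mul k' x = act (norm w) (mul k x))).
  { intros w k k' Hw. induction Hw as [k|l w k k1 k' Hw IH HT].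
    - apply fu_true; [exact HU|]. intros x. symmetry. apply Hact.
    - eapply fu_mono; [exact HU | | apply (fu_inter U HU _ _ IH HT)].
      intros x [E1 E2]. rewrite E2, E1. symmetry. now apply act_norm_cons. }
  eapply fu_mono; [exact HU | | exact Hgen]. clear Hgen. intros x Hx w z Hw.
  destruct w as [|l0 w0]; [reflexivity|].
  assert (Hz : translate mul K x z).
  { inversion Hw; subst. match goal with H : step _ _ _ _ _ |- _ => apply H end. }
  destruct Hz as (k & Hk & Ez).
  (* A walk in the translate lifts to a walk in the pattern with the same word. *)
  assert (Hlift : forall w y, walk (step act (translate mul K x)) w z y ->
            exists k', In k' K /\ y = mul k' x /\ walk T w k k').
  { intros w y Hwy.
    induction Hwy as [y|l w y y1 y' Hwy IH He].
    - exists k. repeat split; auto. constructor.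
    - destruct (IH Hw Ez) as (k1 & Hk1 & -> & Hw1).
      destruct He as (_ & (k' & Hk' & ->) & E).
      exists k'. repeat split; auto. econstructor; [exact Hw1|].
      apply Hx; auto. apply in_letters. }
  destruct (Hlift _ _ Hw) as (k' & Hk' & Ez' & HwT).
  (* Right cancellation closes the lifted walk. *)
  assert (k' = k) by (apply (mul_cancel_r mul one inv HG _ _ x); congruence).
  subst k'. apply HT in HwT.
  (* Otherwise the word fixes finitely many points only, yet it fixes [mul k y] for almost every
     [y]. *)
  apply NNPP. intros Hne.
  destruct (Haf (norm (l0 :: w0)) (reduced_F2mul _ [] eq_refl) Hne) as [l Hl].
  destruct (fu_inhabited U _ HU
    (fu_inter U HU _ _ HwT (fu_cofinite U HU (map (mul (inv k)) l)))) as [y [Ey Hy]].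
  apply Hy. rewrite <- (mul_cancel_l mul one inv HG k y).
  apply in_map. apply Hl. now rewrite <- Ey.
Qed.

(** Each stage adds all inverses and products from the previous one and keeps its elements, so an
    element once reached stays. *)
Lemma exhaustion {H : Type} (mul : H -> H -> H) (one : H) (inv : H -> H) :
  finitely_generated mul one inv ->
  exists K : nat -> list H, forall h, exists N, forall n, (N <= n)%nat -> In h (K n).
Proof.
  intros [S HS].
  pose (K := nat_rect (fun _ => list H) (one :: S) (fun _ L =>
    L ++ map inv L ++ map (fun p => mul (fst p) (snd p)) (list_prod L L))).
  assert (Hmono : forall h m n, (m <= n)%nat -> In h (K m) -> In h (K n)).
  { intros h m n Hmn Hm. induction Hmn as [|n _ IH]; [exact Hm|].
    simpl. apply in_or_app. now left. }
  exists K. intros h.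
  enough (Hex : exists N, In h (K N)) by (destruct Hex as [N HN]; eauto).
  induction (HS h) as [s Hs| |x y _ [M HM] _ [N HN]|x _ [N HN]].
  - exists O. now right.
  - exists O. now left.
  - exists (Datatypes.S (max M N)). simpl. rewrite !in_app_iff. right. right.
    apply (in_map (fun p => mul (fst p) (snd p)) _ (x, y)).
    apply in_prod; [apply (Hmono _ M) | apply (Hmono _ N)]; auto; lia.
  - exists (Datatypes.S N). simpl. rewrite !in_app_iff. right. left.
    now apply in_map.
Qed.

(** The points are chosen recursively: each translate is acyclic and no letter maps any of its
    points into an earlier one. *)
Lemma acyclic_translates {H : Type} (mul : H -> H -> H) one inv
    (HG : is_group mul one inv) (Hinf : infinite_type H)
    (act : list letter -> H -> H) (Hact : F2_action act)
    (Haf : F2_almost_free act) (K : nat -> list H) :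
  exists x : nat -> H,
    acyclic (step act (fun y => exists n, translate mul (K n) (x n) y)).
Proof.
  destruct (free_ultrafilter_exists H Hinf) as [U HU].
  assert (Hfar : forall p : list H * list H, exists x,
    acyclic (step act (translate mul (snd p) x)) /\
    forall y, In y (fst p) -> forall k, In k (snd p) -> forall l, In l letters ->
      act [l] (mul k x) <> y).
  { intros [L M]. apply (fu_inhabited U _ HU). apply (fu_inter U HU).
    - now apply (acyclic_translate mul one inv).
    - apply fu_forall_in; [exact HU|]. intros y _.
      apply fu_forall_in; [exact HU|]. intros k _.
      apply fu_forall_in; [exact HU|]. intros l _.
      (* The equation [act [l] (mul k x) = y] has a single solution [x], which is excluded. *)
      eapply fu_mono; [exact HU | |
        apply (fu_cofinite U HU [mul (inv k) (act [linv l] y)])].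
      intros x Hx <-. apply Hx. left.
      rewrite act_linv by assumption. now apply (mul_cancel_l mul one). }
  destruct (choice _ Hfar) as [f Hf].
  (* [used n] lists the translates of index below [n]. *)
  pose (used := nat_rect (fun _ => list H) [] (fun n L =>
    map (fun k => mul k (f (L, K n))) (K n) ++ L)).
  pose (x := fun n => f (used n, K n)). exists x.
  assert (Hused : forall m n y, (m < n)%nat ->
            translate mul (K m) (x m) y -> In y (used n)).
  { intros m n y Hmn (k & Hk & ->). induction Hmn as [|n _ IH]; simpl.
    - apply in_or_app. left. now apply (in_map (fun k => mul k (x m))).
    - apply in_or_app. now right. }
  assert (Hsep : forall m n l y, (m < n)%nat -> translate mul (K m) (x m) (act [l] y) ->
            ~ translate mul (K n) (x n) y).
  { intros m n l y Hmn Hm (k & Hk & ->).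
    refine (proj2 (Hf (used n, K n)) _ (Hused _ _ _ Hmn Hm) k Hk l (in_letters l) eq_refl). }
  apply acyclic_union.
  - intros n. apply (Hf (used n, K n)).
  - intros m n l y Hm Hn. destruct (lt_eq_lt_dec m n) as [[Hlt|]|Hlt]; [|assumption|].
    (* The edge leaves the earlier translate, so it is reversed. *)
    + exfalso. apply (Hsep m n (linv l) (act [l] y) Hlt); [|exact Hn].
      now rewrite act_linv.
    + exfalso. exact (Hsep n m l y Hlt Hn Hm).
Qed.

(** * Invariant means concentrated on the union of translates *)

(** For fixed [h], whether [mul h (x i)] is in [B] for almost all [i] defines a mean with values 0
    and 1, as [V] is an ultrafilter; [nu] averages these means over [h]. Translating [B] by [g]
    translates the set of such [h] by [g]. *)
Lemma invariant_mean_along {H : Type} (mul : H -> H -> H) one inv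
    (HG : is_group mul one inv) (nu : (H -> Prop) -> R) (Hnu : is_mean nu)
    (Hinv : H_invariant mul nu) {I : Type} (V : (I -> Prop) -> Prop)
    (HV : free_ultrafilter V) (x : I -> H) :
  let mu := fun B : H -> Prop => nu (fun h => V (fun i => B (mul h (x i)))) in
  is_mean mu /\ H_invariant mul mu.
Proof.
  intros mu. destruct Hnu as (Hr & H1 & Hadd). split; [split; [|split]|].
  - intros B. apply Hr.
  - unfold mu. rewrite <- H1. apply f_equal, pred_ext. intros h. split; [auto|].
    intros _. now apply fu_true.
  - intros A B HAB. unfold mu. rewrite <- Hadd.
    + apply f_equal, pred_ext. intros h. split.
      * intros HU. destruct (fu_em V HV (fun i => A (mul h (x i)))) as [HA|HA];
          [now left | right].
        eapply fu_mono; [exact HV | | exact (fu_inter V HV _ _ HU HA)].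
        simpl. tauto.
      * intros [HA|HB]; eapply fu_mono; try eassumption; simpl; tauto.
    + intros h HA HB. apply (fu_false V HV).
      eapply fu_mono; [exact HV | | exact (fu_inter V HV _ _ HA HB)].
      simpl. intros i [Ai Bi]. eauto.
  - intros g B. unfold mu. rewrite <- (Hinv g (fun h => V (fun i => B (mul h (x i))))).
    apply f_equal, pred_ext. intros h.
    pose proof HG as (HA & _). split.
    + intros HB. exists (mul (inv g) h).
      split; [|now rewrite (mul_cancel_inv_l mul one inv HG)].
      eapply fu_mono; [exact HV | | exact HB]. intros i (a & Ba & Ea).
      rewrite <- HA, Ea, (mul_cancel_l mul one inv HG). exact Ba.
    + intros (h' & HB & ->).
      eapply fu_mono; [exact HV | | exact HB]. intros i Bi.
      exists (mul h' (x i)). split; [exact Bi | now rewrite HA].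
Qed.

Lemma infinite_nat : infinite_type nat.
Proof.
  intros [l Hl]. specialize (Hl (Datatypes.S (list_max l))).
  pose proof (proj1 (list_max_le l (list_max l)) (le_n _)) as Hmax.
  rewrite Forall_forall in Hmax. specialize (Hmax _ Hl). lia.
Qed.

Theorem theorem6p1 (H : Type) (mul : H -> H -> H) (one : H) (inv : H -> H)
  (HG : is_group mul one inv) (Hinf : infinite_type H)
  (Hfg : finitely_generated mul one inv) (Ham : amenable mul) :
  ~ exists act : list letter -> H -> H,
      F2_action act /\ F2_transitive act /\ F2_almost_free act /\
      (forall mu : (H -> Prop) -> R,
         is_mean mu -> H_invariant mul mu -> F2_invariant act mu).
Proof.
  intros (act & Hact & _ & Haf & Hmeans).
  destruct Ham as (nu & Hnu & Hnuinv).
  destruct (exhaustion mul one inv Hfg) as [K HK].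
  destruct (acyclic_translates mul one inv HG Hinf act Hact Haf K) as [x Hx].
  set (A := fun y => exists n, translate mul (K n) (x n) y) in Hx.
  destruct (acyclic_labelling _ (step_sym act A Hact) Hx) as [sigma Hsigma].
  destruct (free_ultrafilter_exists nat infinite_nat) as [V HV].
  destruct (invariant_mean_along mul one inv HG nu Hnu Hnuinv V HV x) as [Hmu Hmuinv].
  refine (no_equivariant_labelling act _ A sigma Hmu (Hmeans _ Hmu Hmuinv) _ Hsigma).
  (* Every [h] lies in [K n], and so [mul h (x n)] in [A], for all but finitely many [n]; hence [A]
     has mass 1. *)
  rewrite <- (proj1 (proj2 Hnu)). apply f_equal, pred_ext. intros h.
  split; [auto|]. intros _. destruct (HK h) as [N HN].
  eapply fu_mono; [exact HV | | apply (fu_cofinite V HV (seq 0 N))].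
  intros n Hn. exists n, h. split; [|reflexivity].
  apply HN. cbv beta in Hn. rewrite in_seq in Hn. lia.
Qed.
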